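(* Let $n\ge1$, let $\mathcal{T}$ be the completed tensor algebra on the $\mathbb{Q}$-vector space $H$ with basis $x_1,\dots,x_n$, let $x_0=-\sum_{k=1}^nx_k$, and let $\star$ be the operation on $\mathcal{T}_{\ge1}$ described in the context. Let $\Xi=x_1*x_2*\cdots*x_n=\log(e^{x_1}e^{x_2}\cdots e^{x_n})\in\mathcal{T}_{\ge1}$, and let $(-\Xi)^{-1}$ denote the inverse of $-\Xi$ with respect to $\star$. Then $$(-\Xi)^{-1}+x_0\,s(\Xi)\,x_0=x_0-\sum_{k>l}x_kx_l+\sum_{k=1}^n s(x_k)x_k^2=-\sum_{k>l}x_kx_l+\sum_{k=1}^n\frac{x_k^2}{e^{-x_k}-1},$$ where $s(z)=\frac{1}{e^{-z}-1}+\frac1z$ is substituted as a power series, products being those of $\mathcal{T}$.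
   Context: $\mathcal{T}=\prod_{m\ge0}H^{\otimes m}$ with filtration $\mathcal{T}_{\ge p}=\prod_{m\ge p}H^{\otimes m}$; products in $\mathcal{T}$ are written by juxtaposition. The continuous bilinear operation $\star:\mathcal{T}_{\ge1}\times\mathcal{T}_{\ge1}\to\mathcal{T}_{\ge1}$ is defined by $x_{i_1}\cdots x_{i_{l-1}}x_{i_l}\star x_{j_1}x_{j_2}\cdots x_{j_m}=-\delta_{i_lj_1}\,x_{i_1}\cdots x_{i_{l-1}}x_{j_1}x_{j_2}\cdots x_{j_m}$ for $l,m\ge1$, $1\le i_a,j_b\le n$. It is associative with unit $x_0$, and every $Z\in x_0+\mathcal{T}_{\ge2}$ has a unique inverse $Z^{-1}$ with $Z\star Z^{-1}=Z^{-1}\star Z=x_0$; note $-\Xi\in x_0+\mathcal{T}_{\ge2}$. $s(z)=\frac{1}{e^{-z}-1}+\frac1z=-\frac12-\frac1{12}z+\frac1{720}z^3-\cdots$. *)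

(* Defs.v *)
(* The completed tensor algebra T = prod_m H^{(x)m} over Q,
   H with basis x_1..x_n, is modelled by its coefficient functions:
   an element is a map  seq 'I_n -> rat  sending a word (letter i : 'I_n
   stands for x_{i+1}) to its coefficient.  Every operation below is
   computed coefficientwise by a FINITE sum, which is exactly the
   (convergent in the filtration topology) infinite expression. *)
From mathcomp Require Import all_boot all_order all_algebra.
Set Implicit Arguments. Unset Strict Implicit. Unset Printing Implicit Defensive.
Import Order.TTheory GRing.Theory Num.Theory.
Local Open Scope ring_scope.

Definition tser (n : nat) := seq 'I_n -> rat.

Section TensorSeries.
Variable n : nat.

Definition tzero : tser n := fun _ => 0.
Definition tone : tser n := fun w => if w is [::] then 1 else 0.
Definition tadd (f g : tser n) : tser n := fun w => f w + g w.
Definition topp (f : tser n) : tser n := fun w => - f w.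
Definition tgen (i : 'I_n) : tser n := fun w => if w == [:: i] then 1 else 0.
Definition tmul (f g : tser n) : tser n :=
  fun w => \sum_(k < (size w).+1) f (take k w) * g (drop k w).
Definition tpow (f : tser n) (m : nat) : tser n := iter m (tmul f) tone.
(* substitution of f (with zero constant term) into the power series
   sum_m a_m z^m : only m <= size w contributes to the coefficient of w,
   since f^m lies in T_{>= m}. *)
Definition tsubst (a : nat -> rat) (f : tser n) : tser n :=
  fun w => \sum_(m < (size w).+1) a m * tpow f m w.
Definition texp (f : tser n) : tser n := tsubst (fun m => (m`!%:R)^-1) f.
Definition tlog1p (y : tser n) : tser n :=
  tsubst (fun m => if m is 0 then 0 else (-1) ^+ m.+1 / m%:R) y.
Definition tlog (f : tser n) : tser n := tlog1p (tadd f (topp tone)).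

Definition x0 : tser n := fun w => - \sum_(k < n) tgen k w.

(* the operation star:  x_{i_1}..x_{i_l} * x_{j_1}..x_{j_m}
   = - delta_{i_l j_1} x_{i_1}..x_{i_{l-1}} x_{j_1}..x_{j_m}, extended
   bilinearly and continuously: the coefficient of a word w collects all
   splittings w = u ++ (a :: v). *)
Definition star (f g : tser n) : tser n :=
  fun w => - \sum_(k < size w)
     match drop k w with
     | [::] => 0
     | a :: v => f (rcons (take k w) a) * g (a :: v)
     end.

Definition Xi : tser n :=
  tlog (foldr tmul tone [seq texp (tgen i) | i <- enum 'I_n]).
End TensorSeries.
Arguments x0 n : clear implicits.
Arguments Xi n : clear implicits.
Arguments tone n : clear implicits.
Arguments tzero n : clear implicits.

Definition ps_mul (a b : nat -> rat) : nat -> rat :=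
  fun m => \sum_(i < m.+1) a i * b (m - i)%N.

Fixpoint ps_inv_seq (a : nat -> rat) (m : nat) : seq rat :=
  match m with
  | 0 => [:: (a 0%N)^-1]
  | m'.+1 =>
      let s := ps_inv_seq a m' in
      rcons s (- (a 0%N)^-1 * \sum_(i < m'.+1) a i.+1 * s`_(m' - i))
  end.
Definition ps_inv (a : nat -> rat) : nat -> rat :=
  fun m => (ps_inv_seq a m)`_m.

(* E(z) = (e^{-z} - 1)/z = sum_{m>=0} (-1)^{m+1} z^m/(m+1)! *)
Definition Eser : nat -> rat := fun m => (-1) ^+ m.+1 / (m.+1)`!%:R.

(* s(z) = 1/(e^{-z}-1) + 1/z = (1 + E(z))/(z E(z)) = F(z) / E(z),
   where F(z) = (1 + E(z))/z has coefficients F_m = E_{m+1}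
   (as 1 + E_0 = 0). *)
Definition s_ser : nat -> rat := ps_mul (ps_inv Eser) (fun m => Eser m.+1).

(* z^2/(e^{-z}-1) = z / E(z) *)
Definition q_ser : nat -> rat :=
  fun m => if m is m'.+1 then ps_inv Eser m' else 0.

Definition rhs1 (n : nat) : tser n :=
  fun w => x0 n w
     - \sum_(k < n) \sum_(l < n | (l < k)%N) tmul (tgen k) (tgen l) w
     + \sum_(k < n) tmul (tsubst s_ser (tgen k)) (tpow (tgen k) 2) w.
Definition rhs2 (n : nat) : tser n :=
  fun w => - \sum_(k < n) \sum_(l < n | (l < k)%N) tmul (tgen k) (tgen l) w
     + \sum_(k < n) tsubst q_ser (tgen k) w.
Arguments rhs1 n : clear implicits.
Arguments rhs2 n : clear implicits.

(* Main.v *)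
(* Write X = x_1 + ... + x_n, and for a series f let f_i (resp. f^i) be the series
   with f = f(0) + sum_i f_i x_i = f(0) + sum_i x_i f^i, so that
   f * g = - sum_i f_i x_i g^i for the star product.  With G(z) = (e^z - 1)/z and
   P_k = e^{x_1} ... e^{x_k}, taking f_i of both sides of
   1 + G(Xi) Xi = e^Xi = P_n gives G(Xi) Xi_i = P_{i-1} G(x_i), i.e.
   G(Xi) Xi_i x_i = P_i - P_{i-1}.  With c_i = x_i/(e^{-x_i} - 1) - sum_{l<i} x_l,
   summation by parts yields G(Xi) sum_i Xi_i x_i c_i = - e^Xi X, hence
   sum_i Xi_i x_i c_i = (Xi/(e^{-Xi} - 1)) X.  These c_i are the (rhs2)^i, and
   substituting in the formula for the star product shows that
   rhs2 - x_0 s(Xi) x_0 is a right star-inverse of -Xi.  Right inverses are unique,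
   since star multiplication by an element of x_0 + T_{>=2} is injective; the same
   injectivity and associativity turn a right inverse into a two-sided one. *)
From HB Require Import structures.
Require Import Defs.
From mathcomp Require Import all_boot all_order all_algebra.
From mathcomp Require Import ring boolp.
Import GRing.Theory Num.Theory.
Local Open Scope ring_scope.

(** * Noncommutative power series as an associative algebra over the rationals *)

Section TensorAlgebra.
Variable n : nat.
Implicit Types (f g h : tser n) (w : seq 'I_n) (i a : 'I_n).

(** [lquot i f] is the series $f^i$ and [rquot i f] the series $f_i$ of the overview. *)
Definition lquot a f : tser n := fun w => f (a :: w).
Definition rquot i f : tser n := fun w => f (rcons w i).

Lemma tmul_nil f g : tmul f g [::] = f [::] * g [::].
Proof. by rewrite /tmul big_ord1. Qed.

Lemma tmul_cons f g a w :
  tmul f g (a :: w) = f [::] * g (a :: w) + tmul (lquot a f) g w.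
Proof. by rewrite /tmul big_ord_recl. Qed.

Lemma tmul_rcons f g w i :
  tmul f g (rcons w i) = f (rcons w i) * g [::] + tmul f (rquot i g) w.
Proof.
rewrite /tmul size_rcons big_ord_recr /= addrC.
rewrite take_oversize ?size_rcons // drop_oversize ?size_rcons //.
congr (_ + _); apply: eq_bigr => k _; have k_le : (k <= size w)%N by rewrite -ltnS.
by rewrite /rquot drop_rcons // -cats1 takel_cat.
Qed.

Lemma tmulDl : left_distributive (@tmul n) (@tadd n).
Proof.
move=> f g h; apply: funext => w.
by rewrite /tadd -big_split; apply: eq_bigr => k _; rewrite mulrDl.
Qed.

Lemma tmulDr : right_distributive (@tmul n) (@tadd n).
Proof.
move=> f g h; apply: funext => w.
by rewrite /tadd -big_split; apply: eq_bigr => k _; rewrite mulrDr.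
Qed.

Definition tscale (c : rat) f : tser n := fun w => c * f w.

Lemma tmulZl c f g : tmul (tscale c f) g = tscale c (tmul f g).
Proof.
by apply: funext => w; rewrite /tscale mulr_sumr; apply: eq_bigr => k _; rewrite mulrA.
Qed.

Lemma tmulZr c f g : tmul f (tscale c g) = tscale c (tmul f g).
Proof.
apply: funext => w; rewrite /tscale mulr_sumr; apply: eq_bigr => k _.
by rewrite mulrCA.
Qed.

Lemma lquotM a f g :
  lquot a (tmul f g) = tadd (tscale (f [::]) (lquot a g)) (tmul (lquot a f) g).
Proof. by apply: funext => w; rewrite /lquot tmul_cons. Qed.

(** Left quotients obey the twisted Leibniz rule [lquotM], which drives an induction on the word. *)
Lemma tmulA : associative (@tmul n).
Proof.
move=> f g h; apply: funext => w; elim: w f g h => [|a w IH] f g h.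
  by rewrite !tmul_nil mulrA.
rewrite !tmul_cons lquotM tmul_nil tmulDl tmulZl /tadd /tscale IH mulrDr.
by rewrite !mulrA addrA.
Qed.

Lemma tmul1l : left_id (tone n) (@tmul n).
Proof.
move=> f; apply: funext => -[|a w]; first by rewrite tmul_nil mul1r.
rewrite tmul_cons mul1r /tmul big1 ?addr0 // => k _.
by rewrite /lquot /= mul0r.
Qed.

Lemma tmul1r : right_id (tone n) (@tmul n).
Proof.
move=> f; apply: funext => w; elim: w f => [|a w IH] f; first by rewrite tmul_nil mulr1.
by rewrite tmul_cons mulr0 add0r IH.
Qed.

Lemma taddA : associative (@tadd n).
Proof. by move=> f g h; apply: funext => w; apply: addrA. Qed.
Lemma taddC : commutative (@tadd n).
Proof. by move=> f g; apply: funext => w; apply: addrC. Qed.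
Lemma tadd0l : left_id (tzero n) (@tadd n).
Proof. by move=> f; apply: funext => w; apply: add0r. Qed.
Lemma taddN : left_inverse (tzero n) (@topp n) (@tadd n).
Proof. by move=> f; apply: funext => w; apply: addNr. Qed.
Lemma tone_neq0 : tone n <> tzero n.
Proof. by move=> /(congr1 (fun f => f [::]))/eqP. Qed.

(** The algebraic structures require decidable equality and choice, which are taken classically
    here. *)
HB.instance Definition _ := gen_eqMixin (tser n).
HB.instance Definition _ := gen_choiceMixin (tser n).
HB.instance Definition _ :=
  GRing.isZmodule.Build (tser n) taddA taddC tadd0l taddN.
HB.instance Definition _ := GRing.Zmodule_isNzRing.Build (tser n)
  tmulA tmul1l tmul1r tmulDl tmulDr (introN eqP tone_neq0).

Lemma tscaleA c d f : tscale c (tscale d f) = tscale (c * d) f.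
Proof. by apply: funext => w; apply: mulrA. Qed.
Lemma tscale1 : left_id 1 tscale.
Proof. by move=> f; apply: funext => w; apply: mul1r. Qed.
Lemma tscaleDr : right_distributive tscale +%R.
Proof. by move=> c f g; apply: funext => w; apply: mulrDr. Qed.
Lemma tscaleDl f : {morph tscale^~ f : c d / c + d}.
Proof. by move=> c d; apply: funext => w; apply: mulrDl. Qed.

HB.instance Definition _ := GRing.Zmodule_isLmodule.Build rat (tser n)
  tscaleA tscale1 tscaleDr tscaleDl.
HB.instance Definition _ := GRing.Lmodule_isLalgebra.Build rat (tser n)
  (fun c f g => esym (tmulZl c f g)).
HB.instance Definition _ := GRing.Lalgebra_isAlgebra.Build rat (tser n)
  (fun c f g => esym (tmulZr c f g)).

End TensorAlgebra.

(** * One-letter quotients and the star product *)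

Section Star.
Variable n : nat.
Implicit Types (f g h Z Y : tser n) (w : seq 'I_n) (i j a : 'I_n).
Local Notation x := (@tgen n).

Lemma tserD f g w : (f + g) w = f w + g w. Proof. by []. Qed.
Lemma tserN f w : (- f) w = - f w. Proof. by []. Qed.
Lemma tserZ c f w : (c *: f) w = c * f w. Proof. by []. Qed.
Lemma tserM_nil f g : (f * g) [::] = f [::] * g [::].
Proof. exact: tmul_nil. Qed.

Lemma tser_sum (I : Type) (r : seq I) (P : pred I) (F : I -> tser n) w :
  (\sum_(i <- r | P i) F i) w = \sum_(i <- r | P i) F i w.
Proof. by elim/big_rec2: _ => // i _ f _ <-. Qed.

Lemma tserM_eq0 f g w :
  (forall v, (size v <= size w)%N -> g v = 0) -> (f * g) w = 0.
Proof.
move=> g0; apply: big1 => k _.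
by rewrite g0 ?mulr0 // size_drop leq_subr.
Qed.

Lemma lquot_zmod_morphism a : zmod_morphism (@lquot n a). Proof. by []. Qed.
HB.instance Definition _ a := GRing.isZmodMorphism.Build (tser n) (tser n)
  (@lquot n a) (lquot_zmod_morphism a).
Lemma rquot_zmod_morphism i : zmod_morphism (@rquot n i). Proof. by []. Qed.
HB.instance Definition _ i := GRing.isZmodMorphism.Build (tser n) (tser n)
  (@rquot n i) (rquot_zmod_morphism i).

Lemma lquot_mul a f g :
  lquot n a (f * g) = f [::] *: lquot n a g + lquot n a f * g.
Proof. exact: lquotM. Qed.

Lemma rquot_mul i f g :
  rquot n i (f * g) = f * rquot n i g + g [::] *: rquot n i f.
Proof.
apply: funext => w; rewrite -[LHS]/(tmul f g (rcons w i)) tmul_rcons addrC.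
by rewrite mulrC.
Qed.

Lemma lquot_gen a i : lquot n a (x i) = (a == i)%:R.
Proof.
apply: funext => w; rewrite /lquot /tgen eqseq_cons.
by case: eqP => //; case: w.
Qed.

Lemma rquot_gen i j : rquot n i (x j) = (i == j)%:R.
Proof.
apply: funext => -[|a w]; rewrite /rquot /tgen ?eqseq_cons ?andbT; first by case: eqP.
by rewrite -size_eq0 size_rcons andbF; case: eqP.
Qed.

Lemma sum_rquot (F : 'I_n -> tser n) i :
  rquot n i (\sum_j F j * x j) = F i.
Proof.
rewrite raddf_sum (bigD1 i) //= big1 => [|j /negPf ji].
  by rewrite addr0 rquot_mul rquot_gen eqxx mulr1 scale0r addr0.
by rewrite rquot_mul rquot_gen eq_sym ji mulr0 scale0r addr0.
Qed.

Lemma sum_lquot (F : 'I_n -> tser n) i :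
  lquot n i (\sum_j x j * F j) = F i.
Proof.
rewrite raddf_sum (bigD1 i) //= big1 => [|j /negPf ji].
  by rewrite addr0 lquot_mul lquot_gen eqxx mul1r scale0r add0r.
by rewrite lquot_mul lquot_gen eq_sym ji mul0r scale0r addr0.
Qed.

Lemma lquot_inj f g : f [::] = g [::] -> (forall a, lquot n a f = lquot n a g) -> f = g.
Proof.
move=> fg0 fg; apply: funext => -[|a w] //.
exact: (congr1 (fun h : tser n => h w) (fg a)).
Qed.

Lemma rquot_inj f g : f [::] = g [::] -> (forall i, rquot n i f = rquot n i g) -> f = g.
Proof.
move=> fg0 fg; apply: funext => w; case: (lastP w) => // {}w i.
exact: (congr1 (fun h : tser n => h w) (fg i)).
Qed.

Lemma tser_sum_lquot f : f [::] = 0 -> f = \sum_i x i * lquot n i f.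
Proof.
move=> f0; apply: lquot_inj => [|a]; last by rewrite sum_lquot.
by rewrite f0 tser_sum big1 // => i _; rewrite tserM_nil mul0r.
Qed.

Lemma tser_sum_rquot f : f [::] = 0 -> f = \sum_i rquot n i f * x i.
Proof.
move=> f0; apply: rquot_inj => [|a]; last by rewrite sum_rquot.
by rewrite f0 tser_sum big1 // => i _; rewrite tserM_nil mulr0.
Qed.

Lemma tgenM_nil i f : (x i * f) [::] = 0.
Proof. by rewrite tserM_nil mul0r. Qed.

Lemma tgenM_cons i f a w : (x i * f) (a :: w) = (a == i)%:R * f w.
Proof.
rewrite -[LHS]/(lquot n a (x i * f) w) lquot_mul scale0r add0r lquot_gen.
by case: eqP; rewrite ?mul1r ?mul0r.
Qed.

(** Each splitting of the word contracts exactly one letter; grouping the splittings by that letter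
    gives the sum. *)
Lemma starE f g : star f g = - \sum_i rquot n i f * x i * lquot n i g.
Proof.
apply: funext => w; rewrite tserN tser_sum /star; congr (- _).
transitivity (\sum_i \sum_(k < size w) rquot n i f (take k w) * (x i * lquot n i g) (drop k w)).
  rewrite exchange_big /=; apply: eq_bigr => k _.
  case: (drop k w) => [|a v]; first by rewrite big1 // => i _; rewrite tgenM_nil mulr0.
  rewrite (bigD1 a) //= tgenM_cons eqxx mul1r big1 ?addr0 // => i /negPf ia.
  by rewrite tgenM_cons eq_sym ia mul0r mulr0.
apply: eq_bigr => i _; rewrite -mulrA -[RHS]/(tmul _ _ w) /tmul big_ord_recr /=.
by rewrite drop_size tgenM_nil mulr0 addr0.
Qed.

Lemma star_nil f g : star f g [::] = 0.
Proof. by rewrite /star big_ord0 oppr0. Qed.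

Lemma lquot_star i f g : lquot n i (star f g) =
  - (\sum_j lquot n i (rquot n j f) * x j * lquot n j g + f [:: i] *: lquot n i g).
Proof.
rewrite starE raddfN raddf_sum /=; congr (- _).
under eq_bigr => j _ do rewrite -mulrA lquot_mul mulrA addrC lquot_mul scale0r add0r lquot_gen.
rewrite big_split /=; congr (_ + _).
rewrite (bigD1 i) //= eqxx mul1r big1 ?addr0 // => j /negPf ji.
by rewrite eq_sym ji mul0r scaler0.
Qed.

Lemma rquot_star i f g : rquot n i (star f g) =
  - (\sum_j rquot n j f * x j * rquot n i (lquot n j g) + g [:: i] *: rquot n i f).
Proof.
rewrite starE raddfN raddf_sum /=; congr (- _).
under eq_bigr => j _ do rewrite rquot_mul rquot_mul scale0r addr0 rquot_gen.
rewrite big_split /=; congr (_ + _).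
rewrite (bigD1 i) //= eqxx mulr1 big1 ?addr0 // => j /negPf ji.
by rewrite eq_sym ji mulr0 scaler0.
Qed.

(** Both sides expand to one double sum of terms $f_i x_i\,(\cdot)\,x_j h^j$ and a diagonal sum
    carrying the length-one coefficients of [g]. They agree because left and right quotients of [g]
    commute. *)
Lemma starA f g h : star f (star g h) = star (star f g) h.
Proof.
rewrite (starE f) (starE (star f g)); congr (- _).
under eq_bigr => i _ do rewrite lquot_star mulrN mulrDr mulr_sumr -scalerAr.
under [RHS]eq_bigr => i _ do rewrite rquot_star -mulrA mulNr mulrDl mulr_suml -scalerAl mulrA.
rewrite !sumrN !big_split exchange_big /=; congr (- (_ + _)).
by apply: eq_bigr => i _; apply: eq_bigr => j _; rewrite !mulrA.
Qed.

Lemma x0E : x0 n = - \sum_i x i.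
Proof. by apply: funext => w; rewrite tserN tser_sum. Qed.

Lemma x0_nil : x0 n [::] = 0.
Proof. by rewrite /x0 big1 ?oppr0. Qed.

Lemma lquot_x0 i : lquot n i (x0 n) = -1.
Proof.
rewrite x0E raddfN; congr (- _); rewrite -[RHS](sum_lquot (fun=> 1) i).
by under [in RHS]eq_bigr => j _ do rewrite mulr1.
Qed.

Lemma rquot_x0 i : rquot n i (x0 n) = -1.
Proof.
rewrite x0E raddfN; congr (- _); rewrite -[RHS](sum_rquot (fun=> 1) i).
by under [in RHS]eq_bigr => j _ do rewrite mul1r.
Qed.

Lemma star_x0l f : f [::] = 0 -> star (x0 n) f = f.
Proof.
move=> f0; rewrite starE [RHS]tser_sum_lquot // -sumrN.
by apply: eq_bigr => i _; rewrite rquot_x0 mulN1r mulNr opprK.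
Qed.

Lemma star_x0r f : f [::] = 0 -> star f (x0 n) = f.
Proof.
move=> f0; rewrite starE [RHS]tser_sum_rquot // -sumrN.
by apply: eq_bigr => i _; rewrite lquot_x0 mulrN1 opprK.
Qed.

(** The coefficient $-1$ of every letter in [Z] expresses the difference [D] through its own values
    on shorter words, so [D] vanishes by induction on length. *)
Lemma star_lcancel Z Y Y' : (forall i, Z [:: i] = -1) ->
  Y [::] = Y' [::] -> star Z Y = star Z Y' -> Y = Y'.
Proof.
move=> Z1 YY'0 ZYY'; apply/eqP; rewrite -subr_eq0; apply/eqP.
set D := Y - Y'.
have ZD : star Z D = 0.
  rewrite starE; under eq_bigr => i _ do rewrite raddfB mulrBr.
  by move: ZYY'; rewrite sumrB !starE => /oppr_inj ->; rewrite subrr oppr0.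
have D0 : D [::] = 0 by rewrite /D tserD tserN YY'0 subrr.
have lquotD i : lquot n i D = \sum_j lquot n i (rquot n j Z) * (x j * lquot n j D).
  have := lquot_star i Z D; rewrite ZD Z1 raddf0 scaleN1r => /esym/eqP.
  rewrite oppr_eq0 subr_eq0 => /eqP <-.
  by apply: eq_bigr => j _; rewrite mulrA.
apply: funext => w; have [m] := ubnP (size w); elim: m w => // m IH [|a w] //= w_lt.
rewrite -[LHS]/(lquot n a D w) lquotD tser_sum big1 // => j _.
(* The term $x_j D^j$ evaluates [D] at words no longer than [w], hence shorter than [a :: w]. *)
apply: tserM_eq0 => -[|b v] v_le; first exact: tgenM_nil.
rewrite tgenM_cons; case: eqP => [<-|]; last by rewrite mul0r.
by rewrite mul1r /lquot IH //= (leq_ltn_trans v_le).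
Qed.

End Star.

(** * Substitution into power series in one variable *)

Section Substitution.
Variables (n : nat) (y : tser n).
Hypothesis y0 : y [::] = 0.
Implicit Types (a b : nat -> rat) (p q : {poly rat}) (w : seq 'I_n).

Lemma tpowE (f : tser n) m : tpow f m = f ^+ m.
Proof. by elim: m => // m IH; rewrite exprS -IH. Qed.

Lemma tserM_congr (f f' g g' : tser n) w :
  (forall v, (size v <= size w)%N -> f v = f' v) ->
  (forall v, (size v <= size w)%N -> g v = g' v) ->
  (f * g) w = (f' * g') w.
Proof.
move=> ff' gg'; apply: eq_bigr => k _.
by rewrite ff' ?gg' // ?size_drop ?leq_subr // size_take_min geq_minr.
Qed.

Lemma tserX_congr (f g : tser n) w m :
  (forall v, (size v <= size w)%N -> f v = g v) -> (f ^+ m) w = (g ^+ m) w.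
Proof.
move=> fg; have: (size w <= size w)%N by []. 
elim: m {-2}w => // m IH v v_le; rewrite !exprS; apply: tserM_congr => u u_le.
  by apply: fg; apply: leq_trans v_le.
by apply: IH; apply: leq_trans v_le.
Qed.

Lemma tserX_eq0 w m : (size w < m)%N -> (y ^+ m) w = 0.
Proof.
elim: m w => // m IH [|a w] w_lt; rewrite exprS.
  by rewrite tserM_nil y0 mul0r.
rewrite -[LHS]/(tmul _ _ _) tmul_cons y0 mul0r add0r.
by apply: tserM_eq0 => v v_le; apply: IH; apply: leq_ltn_trans v_le _.
Qed.

(** Powers of [y] beyond the length of [w] vanish at [w], so a polynomial with the right low
    coefficients can replace the power series. Ring identities then transfer through the morphism
    [horner_alg]. *)
Lemma tsubst_horner a p w : (forall k, (k <= size w)%N -> p`_k = a k) ->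
  horner_alg y p w = tsubst a y w.
Proof.
move=> pa; set N := maxn (size p) (size w).+1.
have -> : p = \poly_(i < N) p`_i.
  apply/polyP => i; rewrite coef_poly; case: ltnP => // N_le.
  by rewrite nth_default // (leq_trans _ N_le) ?leq_maxl.
rewrite poly_def raddf_sum /= tser_sum /tsubst.
rewrite (big_ord_widen N (fun m => a m * tpow y m w)) ?leq_maxr //.
rewrite [RHS]big_mkcond; apply: eq_bigr => i _.
rewrite linearZ /= rmorphXn /= horner_algX mulr_algl tserZ tpowE.
by case: ltnP => [i_lt|i_ge]; [rewrite pa | rewrite tserX_eq0 ?mulr0].
Qed.

Lemma horner_alg_congr p q w : (forall k, (k <= size w)%N -> p`_k = q`_k) ->
  horner_alg y p w = horner_alg y q w.
Proof. by move=> pq; rewrite !(tsubst_horner (fun k => q`_k)). Qed.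

Lemma tsubst_poly a N w : (size w < N)%N ->
  tsubst a y w = horner_alg y (\poly_(i < N) a i) w.
Proof.
move=> w_lt; rewrite (tsubst_horner a) // => k k_le.
by rewrite coef_poly (leq_ltn_trans k_le w_lt).
Qed.

Lemma eq_tsubst a b : a =1 b -> tsubst a y = tsubst b y.
Proof. by move=> ab; apply: funext => w; apply: eq_bigr => k _; rewrite ab. Qed.

Lemma tsubst_mul a b : tsubst (ps_mul a b) y = tsubst a y * tsubst b y.
Proof.
apply: funext => w; set N := (size w).+1.
rewrite (@tserM_congr _ (horner_alg y (\poly_(i < N) a i))
   _ (horner_alg y (\poly_(i < N) b i))); try by move=> v v_le; apply: tsubst_poly.
rewrite -rmorphM /= (tsubst_horner (ps_mul a b)) // => k k_le.
rewrite coefM; apply: eq_bigr => i _; rewrite !coef_poly /N !ltnS.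
by rewrite (leq_trans _ k_le) ?(leq_trans _ k_le) ?leq_subr // -ltnS.
Qed.

Lemma tsubst_comm a b : tsubst a y * tsubst b y = tsubst b y * tsubst a y.
Proof.
rewrite -!tsubst_mul; apply: eq_tsubst => m; rewrite /ps_mul.
rewrite (reindex_inj rev_ord_inj); apply: eq_bigr => i _ /=.
by rewrite subSS subKn -1?ltnS // mulrC.
Qed.

Lemma tsubst_recr a : tsubst a y = (a 0)%:A + tsubst (a \o succn) y * y.
Proof.
apply: funext => w; set N := (size w).+1.
pose q := \poly_(i < N) a i.+1.
transitivity (horner_alg y ((a 0)%:P + q * 'X) w).
  rewrite (tsubst_horner a) // => -[|k] k_le; rewrite coefD coefC coefMX /= ?addr0 //.
  by rewrite add0r coef_poly leqW.
rewrite rmorphD rmorphM /= horner_algC horner_algX !tserD; congr (_ + _).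
by apply: tserM_congr => // v v_le; rewrite (tsubst_poly _ N).
Qed.

Lemma tsubst_z : tsubst (fun m => (m == 1%N)%:R) y = y.
Proof.
apply: funext => w; rewrite -(tsubst_horner _ 'X) ?horner_algX // => k _.
by rewrite coefX.
Qed.

Lemma tsubst_commz a : tsubst a y * y = y * tsubst a y.
Proof. by rewrite -{2 3}tsubst_z tsubst_comm. Qed.

Lemma tsubst_nil a : tsubst a y [::] = a 0.
Proof. by rewrite /tsubst big_ord1 /= mulr1. Qed.

Lemma tsubst1 : tsubst (fun m => (m == 0%N)%:R) y = 1.
Proof.
apply: funext => w; rewrite -(tsubst_horner _ 1) ?rmorph1 // => k _.
by rewrite coef1.
Qed.

End Substitution.

(** * Coefficient identities for exponential, logarithm and reciprocal *)

Section PowerSeries.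
Implicit Types (a b : nat -> rat).

Definition exp_ser : nat -> rat := fun m => (m`!%:R)^-1.
Definition expN_ser : nat -> rat := fun m => (-1) ^+ m / m`!%:R.
(* (e^z - 1)/z *)
Definition expm1_ser : nat -> rat := fun m => ((m.+1)`!%:R)^-1.
Definition log_ser : nat -> rat := fun m => if m is 0 then 0 else (-1) ^+ m.+1 / m%:R.

Lemma natr_neq0 m : (m.+1%:R : rat) != 0.
Proof. by rewrite pnatr_eq0. Qed.

Lemma factr_neq0 m : (m`!%:R : rat) != 0.
Proof. by rewrite pnatr_eq0 -lt0n fact_gt0. Qed.

(** By the binomial theorem the coefficient is $(1-1)^m/m!$. *)
Lemma exp_ser_mulN m : ps_mul exp_ser expN_ser m = (m == 0)%:R.
Proof.
have -> : ps_mul exp_ser expN_ser m = (m`!%:R)^-1 * (1 - 1) ^+ m.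
  rewrite exprBn mulr_sumr [LHS](reindex_inj rev_ord_inj); apply: eq_bigr => i _ /=.
  have i_le : (i <= m)%N by rewrite -ltnS.
  rewrite subSS subKn // !expr1n !mulr1 /exp_ser /expN_ser -mulr_natr.
  rewrite -(bin_fact i_le) !natrM.
  have Ci : ('C(m, i)%:R : rat) != 0 by rewrite pnatr_eq0 -lt0n bin_gt0.
  by field; rewrite !factr_neq0 Ci.
by rewrite subrr expr0n; case: m => [|m]; rewrite ?mulr0 // mulr1.
Qed.

(** This is $e^z(e^{-z}-1)/z=-(e^z-1)/z$, read off in degree $m+1$ of $e^ze^{-z}=1$ by isolating the
    last summand. *)
Lemma exp_ser_mulE m : ps_mul exp_ser Eser m = - expm1_ser m.
Proof.
have := exp_ser_mulN m.+1; rewrite /ps_mul big_ord_recr /= subnn /expN_ser.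
rewrite divr1 => /eqP; rewrite addr_eq0 => /eqP <-.
by apply: eq_bigr => i _; rewrite subSn // -ltnS.
Qed.

Lemma size_ps_inv_seq a m : size (ps_inv_seq a m) = m.+1.
Proof. by elim: m => //= m IH; rewrite size_rcons IH. Qed.

Lemma nth_ps_inv_seq a m k : (k <= m)%N -> (ps_inv_seq a m)`_k = ps_inv a k.
Proof.
elim: m => [|m IH]; first by case: k.
rewrite leq_eqVlt => /orP[/eqP-> //|k_lt].
by rewrite /= nth_rcons size_ps_inv_seq k_lt IH.
Qed.

Lemma ps_mul_inv a m : a 0 != 0 -> ps_mul a (ps_inv a) m = (m == 0)%:R.
Proof.
move=> a0; rewrite /ps_mul; case: m => [|m].
  by rewrite big_ord1 /= divff.
rewrite big_ord_recl /= subn0 {1}/ps_inv /= nth_rcons size_ps_inv_seq ltnn eqxx.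
rewrite mulrA mulrN divff // mulN1r addrC; apply/eqP; rewrite subr_eq0; apply/eqP.
by apply: eq_bigr => i _; rewrite nth_ps_inv_seq ?leq_subr // subSS.
Qed.

(* With [c := exp_N \Po log_N], the relations exp' = exp and (1 + X) log' = 1
   give (1 + X) c' = c modulo X^N, which determines c modulo X^(N+1). *)
Lemma coef_exp_log N k : (k <= N)%N ->
  ((\poly_(i < N.+1) exp_ser i) \Po (\poly_(i < N.+1) log_ser i))`_k = (1 + 'X)`_k.
Proof.
set p := \poly_(i < N.+1) exp_ser i; set q := \poly_(i < N.+1) log_ser i.
set c := p \Po q.
have q0 : q.[0] = 0 by rewrite horner_coef0 coef_poly.
have dp : p^`() = p - (exp_ser N)%:P * 'X^N.
  apply/polyP => i; rewrite coef_deriv coefB coefCM coefXn !coef_poly !ltnS.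
  case: ltngtP => [i_lt|i_gt|->]; last by rewrite mulr1 subrr mul0rn.
    rewrite mulr0 subr0 /exp_ser factS natrM -mulr_natr.
    by field; rewrite factr_neq0 nat1r natr_neq0.
  by rewrite mul0rn mulr0 subr0.
have dq : (1 + 'X) * q^`() = 1 - (- 'X) ^+ N.
  have -> : q^`() = \sum_(i < N) (- 'X) ^+ i.
    transitivity (\poly_(i < N) ((-1) ^+ i : rat)).
      apply/polyP => i; rewrite coef_deriv !coef_poly ltnS.
      case: ltnP => _; rewrite ?mul0rn // /log_ser -[LHS]mulr_natr divfK ?natr_neq0 //.
      by rewrite !exprS !mulN1r opprK.
    rewrite poly_def; apply: eq_bigr => i _.
    by rewrite [RHS]exprNn -mul_polyC rmorphXn rmorphN1.
  by rewrite -[RHS]opprB subrX1 -mulNr opprB opprK.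
have [r qr] : exists r, q = r * 'X.
  by have /factor_theorem[r ->] : root q 0 by [apply/eqP]; exists r; rewrite subr0.
have dc : exists h, (1 + 'X) * c^`() = c + h * 'X^N.
  (* The witness collects the truncation defects: the top term missing in [dp] becomes a multiple of
     $r^NX^N$ after composition with $q=rX$, and the geometric sum in [dq] leaves $(-X)^N$. *)
  exists (- (exp_ser N)%:P * r ^+ N * (1 - (- 'X) ^+ N) - c * (-1) ^+ N).
  rewrite deriv_comp mulrCA dq dp comp_polyB comp_polyM comp_polyC comp_Xn_poly -/c.
  by rewrite qr exprMn [(- 'X) ^+ N]exprNn; ring.
have [h dch] := dc.
have c0 : c`_0 = 1.
  by rewrite -horner_coef0 horner_comp q0 horner_coef0 coef_poly.
clearbody c; clear dc dq dp r qr q0 p q.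
have rec j : (j < N)%N -> c`_j.+1 *+ j.+1 = c`_j * (1 - j%:R).
  move=> j_lt; have := congr1 (fun u : {poly rat} => u`_j) dch.
  rewrite /= mulrDl mul1r [LHS]coefD [RHS]coefD [(h * _)`_j]coefMXn j_lt addr0.
  rewrite coefXM !coef_deriv.
  case: j j_lt => [|j] j_lt /=; first by rewrite addr0 => ->; rewrite subr0 mulr1.
  by rewrite mulrBr mulr1 mulr_natr => eqc; rewrite -{1}eqc addrK.
rewrite coefD coef1 coefX.
case: k => [|[|k]] k_le /=; first by rewrite c0 addr0.
  by have := rec 0%N k_le; rewrite c0 subr0 mulr1 add0r.
(* The factor $1-j$ in [rec] vanishes at $j=1$, which kills the coefficient of degree 2 and then all
   higher ones. *)
rewrite addr0; elim: k k_le => [|k IH] k_le; apply/eqP.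
  by have /eqP := rec 1%N k_le; rewrite subrr mulr0 mulrn_eq0.
have /eqP := rec k.+2 k_le.
by rewrite IH ?mul0r ?mulrn_eq0 // ltnW.
Qed.

End PowerSeries.

(** * Exponential and related series evaluated at a tensor series *)

Section ExpLog.
Variables (n : nat) (y : tser n).
Hypothesis y0 : y [::] = 0.

Lemma tlog1p_nil : tlog1p y [::] = 0.
Proof. by rewrite /tlog1p tsubst_nil. Qed.

(** At a word only degrees up to its length matter, so the truncated identity [coef_exp_log]
    suffices. *)
Lemma texp_tlog1p : texp (tlog1p y) = 1 + y.
Proof.
apply: funext => w; set N := size w.
pose q : {poly rat} := \poly_(i < N.+1) log_ser i.
pose p : {poly rat} := \poly_(i < N.+1) exp_ser i.
have -> : (1 + y) w = horner_alg y (1 + 'X) w.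
  by rewrite rmorphD rmorph1 /= horner_algX.
rewrite -(@horner_alg_congr n y y0 (p \Po q)); last by move=> k /coef_exp_log.
rewrite /p poly_def raddf_sum raddf_sum /= tser_sum /texp /tsubst.
apply: eq_bigr => i _; rewrite comp_polyZ comp_Xn_poly linearZ /=.
rewrite mulr_algl tserZ rmorphXn /= tpowE; congr (_ * _).
apply: tserX_congr => v v_le; exact: tsubst_poly.
Qed.

(** Here [eN] is $e^{-y}$, [G] is $(e^y-1)/y$, [E] is $(e^{-y}-1)/y$ and [v] is $y/(e^{-y}-1)$. *)
Let eN := tsubst expN_ser y.
Let G := tsubst expm1_ser y.
Let E := tsubst Eser y.
Let v := tsubst (ps_inv Eser) y.

Lemma texp_rec : texp y = 1 + G * y.
Proof. by rewrite /texp tsubst_recr // scale1r. Qed.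

Lemma tsubst_expN_texp : eN * texp y = 1.
Proof.
rewrite /eN /texp -/exp_ser tsubst_comm // -tsubst_mul // -[RHS](tsubst1 n y y0).
by apply: eq_tsubst => m; rewrite exp_ser_mulN.
Qed.

Lemma tsubst_E_inv : E * v = 1.
Proof.
rewrite /E -tsubst_mul // -[RHS](tsubst1 n y y0).
by apply: eq_tsubst => m; rewrite ps_mul_inv.
Qed.

Lemma tsubst_expm1E : G = - (texp y * E).
Proof.
rewrite /texp -/exp_ser -tsubst_mul //; apply: funext => w; rewrite tserN -sumrN.
by apply: eq_bigr => m _; rewrite exp_ser_mulE mulNr opprK.
Qed.

Lemma tsubst_expm1_inv : G * v = - texp y.
Proof. by rewrite tsubst_expm1E mulNr -mulrA tsubst_E_inv mulr1. Qed.

(** [G] equals $-e^yE$, and [eN] and [v] invert the two factors. *)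
Lemma tsubst_expm1_lcancel (f g : tser n) : G * f = G * g -> f = g.
Proof.
have Gl : - (v * eN) * G = 1.
  rewrite tsubst_expm1E mulNr mulrN opprK mulrA -(mulrA v) tsubst_expN_texp mulr1.
  by rewrite tsubst_comm // tsubst_E_inv.
by move=> Gfg; rewrite -[f]mul1r -[g]mul1r -Gl -!mulrA Gfg.
Qed.

(** With $s=F/E$ and $zF(z)=1+E(z)$, this is $z\,s(z)=1/E(z)+1$. *)
Lemma tsubst_s_mul : tsubst s_ser y * y = v + 1.
Proof.
have E_rec : E = - 1 + tsubst (fun m => Eser m.+1) y * y.
  by rewrite /E tsubst_recr // /Eser /= expr1 divr1 scaleN1r.
rewrite /s_ser tsubst_mul // -mulrA.
have -> : tsubst (fun m => Eser m.+1) y * y = E + 1 by rewrite E_rec addrAC addNr add0r.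
by rewrite mulrDr mulr1 tsubst_comm // tsubst_E_inv addrC.
Qed.

Lemma tsubst_q : tsubst q_ser y = v * y.
Proof. by rewrite tsubst_recr // scale0r add0r. Qed.

End ExpLog.

(** * The product of exponentials and the star inverse *)

Section Main.
Variable n : nat.
Local Notation x := (@tgen n).
Local Notation v i := (tsubst (ps_inv Eser) (x i)).
Local Notation X := (\sum_i x i).
Implicit Types (s : seq 'I_n) (i k : 'I_n) (A : tser n).

Lemma texp_nil (f : tser n) : texp f [::] = 1.
Proof. by rewrite /texp tsubst_nil invr1. Qed.

Definition exp_prod s : tser n := foldr (@tmul n) (tone n) [seq texp (x i) | i <- s].

Lemma exp_prod_cons i s : exp_prod (i :: s) = texp (x i) * exp_prod s.
Proof. by []. Qed.

Lemma exp_prod_nil s : exp_prod s [::] = 1.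
Proof. by elim: s => // i s IH; rewrite exp_prod_cons tserM_nil texp_nil IH mulr1. Qed.

(** Since $e^{x_k}=1+G(x_k)x_k$, the first factor has a nonzero right quotient only at [k]; the tail
    has constant term 1. *)
Lemma rquot_exp_prod_cons i k s : rquot n i (exp_prod (k :: s)) =
  texp (x k) * rquot n i (exp_prod s) + tsubst expm1_ser (x k) * (i == k)%:R.
Proof.
rewrite exp_prod_cons rquot_mul exp_prod_nil scale1r; congr (_ + _).
rewrite texp_rec // raddfD /= rquot_mul scale0r addr0 rquot_gen.
by rewrite (_ : rquot n i 1 = 0) ?add0r //; apply: funext => -[].
Qed.

(* Abel summation along the factors of the product: [c] carries, at each letter of
   [s], minus the sum of the letters preceding it ([A] being the contribution of
   the letters already removed). *)
Lemma sum_rquot_exp_prod s A (c : 'I_n -> tser n) :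
  (forall s1 i s2, s = s1 ++ i :: s2 -> c i = v i - (A + \sum_(l <- s1) x l)) ->
  \sum_i rquot n i (exp_prod s) * (x i * c i) =
    A - exp_prod s * (A + \sum_(l <- s) x l).
Proof.
elim: s A => [|k s IH] A cE.
  rewrite big_nil addr0 mul1r subrr big1 // => i _.
  by rewrite (_ : rquot n i _ = 0) ?mul0r //; apply: funext => -[].
under eq_bigr => i _ do rewrite rquot_exp_prod_cons mulrDl -!mulrA.
(* Once removed, [k] precedes every remaining letter, so the induction continues with [A + x k]. *)
rewrite big_split /= -mulr_sumr (IH (A + x k)); last first.
  by move=> s1 i s2 es; rewrite (cE (k :: s1) i s2) ?es // big_cons addrA.
rewrite [X in _ + X](bigD1 k) //= eqxx mul1r [X in _ + (_ + X)]big1 ?addr0; last first.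
  by move=> i /negPf ->; rewrite mul0r mulr0.
rewrite (cE [::] k s) // big_nil addr0 big_cons exp_prod_cons addrA.
(* This combines $G(x_k)v_k=-e^{x_k}$ with $G(x_k)x_k=e^{x_k}-1$. *)
have -> : tsubst expm1_ser (x k) * (x k * (v k - A)) =
    - (texp (x k) * x k) - (texp (x k) - 1) * A.
  rewrite mulrBr -tsubst_commz // mulrBr !mulrA tsubst_expm1_inv // mulNr.
  by rewrite [X in X - 1]texp_rec // [1 + _]addrC addrK.
rewrite mulrBr mulrDr mulrBl mul1r opprB mulrA addrA.
by rewrite [_ - _ - _]addrAC addrK addrC subrKA.
Qed.

(** The enumeration of ['I_n] is strictly increasing, so the letters before [i] are exactly those of
    smaller index. *)
Lemma sum_enum_lt s1 i s2 (F : 'I_n -> tser n) : enum 'I_n = s1 ++ i :: s2 ->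
  \sum_(l < n | (l < i)%N) F l = \sum_(l <- s1) F l.
Proof.
move=> e12; have : sorted ltn (map val (enum 'I_n)) by rewrite val_enum_ord iota_ltn_sorted.
rewrite sorted_map (sorted_pairwise) => [|a b c]; last exact: ltn_trans.
rewrite e12 pairwise_cat /= allrel_consr => /and3P[/andP[/allP s1i _] _ /andP[/allP is2 _]].
transitivity (\sum_(l <- enum 'I_n | (l < i)%N) F l).
  by rewrite big_enum_cond; apply: eq_bigl.
rewrite e12 big_cat /= big_cons ltnn [X in _ + X]big1_seq ?addr0.
  by rewrite big_seq_cond [RHS]big_seq; apply: eq_bigl => l; apply: andb_idr => /s1i.
by move=> l /andP[l_lt /is2 /=]; rewrite ltnNge ltnW.
Qed.

Local Notation P := (exp_prod (enum 'I_n)).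
Local Notation u := (tsubst (ps_inv Eser) (Xi n)).

Lemma Xi_nil : Xi n [::] = 0.
Proof. by rewrite /Xi /tlog tlog1p_nil // [tadd _ _ _]subrr. Qed.

Lemma texp_Xi : texp (Xi n) = P.
Proof.
rewrite /Xi /tlog -/(exp_prod _) texp_tlog1p; first by rewrite addrC subrK.
by rewrite -[LHS]/(P [::] - 1) exp_prod_nil subrr.
Qed.

Lemma sum_rquot_Xi (c : 'I_n -> tser n) :
  (forall i, c i = v i - \sum_(l < n | (l < i)%N) x l) ->
  \sum_i rquot n i (Xi n) * (x i * c i) = u * X.
Proof.
move=> cE; apply: (tsubst_expm1_lcancel _ (Xi n) Xi_nil).
rewrite mulrA tsubst_expm1_inv ?Xi_nil // texp_Xi mulr_sumr.
under eq_bigr => i _ do rewrite mulrA.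
(* $G(\Xi)\,\Xi_i$ is the right quotient of [P] by [i], because $P=e^\Xi=1+G(\Xi)\,\Xi$. *)
transitivity (\sum_i rquot n i P * (x i * c i)).
  apply: eq_bigr => i _; rewrite -texp_Xi texp_rec ?Xi_nil // raddfD /= rquot_mul Xi_nil.
  rewrite scale0r addr0 (_ : rquot n i 1 = 0) ?add0r //.
  by apply: funext => -[].
rewrite (sum_rquot_exp_prod _ 0) => [|s1 i s2 es]; last first.
  by rewrite cE (sum_enum_lt _ _ _ _ es) add0r.
by rewrite !add0r mulNr big_enum.
Qed.

(** Each term begins with a generator: $z^2/(e^{-z}-1)$ at $x_k$ is $x_kv_k$. *)
Lemma lquot_rhs2 i : lquot n i (rhs2 n) = v i - \sum_(l < n | (l < i)%N) x l.
Proof.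
have -> : rhs2 n = \sum_k x k * (v k - \sum_(l < n | (l < k)%N) x l).
  apply: funext => w; rewrite /rhs2 addrC tser_sum -sumrN -big_split /=.
  apply: eq_bigr => k _; rewrite mulrBr tserD tserN mulr_sumr tser_sum.
  by rewrite tsubst_q // tsubst_commz.
exact: sum_lquot.
Qed.

(** $s(x_k)x_k^2=(v_k+1)x_k$, and the extra summands $x_k$ cancel $x_0$. *)
Lemma rhs12 : rhs1 n = rhs2 n.
Proof.
apply: funext => w; rewrite /rhs1 /rhs2 addrAC [RHS]addrC; congr (_ - _).
rewrite /x0 -sumrN -big_split /=; apply: eq_bigr => k _.
rewrite -[LHS]/((- x k + tsubst s_ser (x k) * tpow (x k) 2) w) tpowE expr2 mulrA tsubst_s_mul //.
by rewrite mulrDl mul1r addrC addrK tsubst_q.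
Qed.

Definition Xi_inv : tser n := rhs2 n - x0 n * tsubst s_ser (Xi n) * x0 n.

Lemma Xi_inv_nil : Xi_inv [::] = 0.
Proof.
rewrite /Xi_inv tserD tserN !tserM_nil x0_nil mulr0 subr0 -rhs12.
rewrite /rhs1 x0_nil sub0r !big1 ?oppr0 ?addr0 // => k _.
  by rewrite [tmul _ _ _]tserM_nil tpowE expr2 tgenM_nil mulr0.
by rewrite big1 // => l _; rewrite [tmul _ _ _]tgenM_nil.
Qed.

Lemma lquot_Xi_inv i : lquot n i Xi_inv =
  v i - \sum_(l < n | (l < i)%N) x l + tsubst s_ser (Xi n) * x0 n.
Proof.
rewrite /Xi_inv raddfB /= lquot_rhs2 -mulrA lquot_mul x0_nil scale0r add0r.
by rewrite lquot_x0 mulN1r opprK.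
Qed.

(** The product is $uX+\Xi\,s(\Xi)\,x_0=uX+(u+1)x_0$, and $x_0=-X$. *)
Lemma star_Xi_inv : star (- Xi n) Xi_inv = x0 n.
Proof.
rewrite starE.
under eq_bigr => i _ do rewrite raddfN /= lquot_Xi_inv !mulNr mulrDr -mulrA.
rewrite sumrN opprK big_split /= sum_rquot_Xi // -mulr_suml -tser_sum_rquot ?Xi_nil //.
rewrite mulrA -tsubst_commz ?Xi_nil // tsubst_s_mul ?Xi_nil //.
by rewrite mulrDl mul1r x0E mulrN addrA subrr add0r.
Qed.

End Main.

(* (-Xi)^{-1} is the (unique) Y in T_{>=1} with (-Xi) * Y = Y * (-Xi) = x_0
   (star-inverse); we assert it exists and that every such Y satisfies
   the identity. *)
Theorem theorem3p1 (n : nat) (hn : (1 <= n)%N) :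
  (exists Y : tser n, Y [::] = 0 /\
     star (topp (Xi n)) Y = x0 n /\ star Y (topp (Xi n)) = x0 n) /\
  (forall Y : tser n, Y [::] = 0 ->
     star (topp (Xi n)) Y = x0 n -> star Y (topp (Xi n)) = x0 n ->
     tadd Y (tmul (tmul (x0 n) (tsubst s_ser (Xi n))) (x0 n)) = rhs1 n /\
     rhs1 n = rhs2 n).
Proof.
(* The linear part of $\Xi$ is found without expanding the logarithm: comparing coefficients at
   [[:: i]] in [star_Xi_inv] yields it from that of [Xi_inv]. *)
have Xi_gen i : (- Xi n) [:: i] = -1.
  have : Xi_inv n [:: i] = -1.
    rewrite -[LHS]/(lquot n i (Xi_inv n) [::]) lquot_Xi_inv !tserD tserN tserM_nil.
    by rewrite x0_nil mulr0 addr0 tser_sum big1 // oppr0 addr0 tsubst_nil.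
  have := congr1 (fun f => f [:: i]) (star_Xi_inv n).
  rewrite /star big_ord1 -[RHS]/(lquot n i (x0 n) [::]) lquot_x0 => /oppr_inj /= + Yi.
  by rewrite Yi mulrN1 => /(canRL (@opprK _)).
have unique Y : Y [::] = 0 -> star (- Xi n) Y = x0 n -> Y = Xi_inv n.
  move=> Y0 ZY; apply: (@star_lcancel n (- Xi n)) => //.
    by rewrite Y0 Xi_inv_nil.
  by rewrite ZY star_Xi_inv.
split; last first.
  move=> Y Y0 ZY _; rewrite (unique Y Y0 ZY); split; last exact: rhs12.
  by rewrite rhs12; apply: (subrK (x0 n * tsubst s_ser (Xi n) * x0 n)).
exists (Xi_inv n); split; first exact: Xi_inv_nil.
split; first exact: star_Xi_inv.
(* After left star multiplication by [- Xi n], associativity and the unit laws make both sides equal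
   to [- Xi n]. *)
apply: (@star_lcancel n (- Xi n)) => //; first by rewrite star_nil x0_nil.
rewrite -[topp _]/(- Xi n) starA star_Xi_inv star_x0l ?star_x0r //.
  by rewrite tserN Xi_nil oppr0.
by rewrite tserN Xi_nil oppr0.
Qed.
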